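(* A prime $p$ is a Wolstenholme prime if and only if $$\binom{2p-1}{p-1} \equiv 1 - 2p\sum_{k=1}^{p-1}\frac{1}{k} - 2p^2\sum_{k=1}^{p-1}\frac{1}{k^2} \pmod{p^7}.$$
   Context: A prime $p$ is called a Wolstenholme prime if $\binom{2p-1}{p-1}\equiv 1 \pmod{p^4}$. Congruences between rational numbers modulo $p^e$ are understood in the ring of rationals with denominator prime to $p$: $a\equiv b \pmod{p^e}$ means that $a-b$, written in reduced form, has numerator divisible by $p^e$ and denominator prime to $p$. *)

(* Defs.v *)
From mathcomp Require Import all_boot all_order all_algebra.

Set Implicit Arguments.
Unset Strict Implicit.
Unset Printing Implicit Defensive.

Import Order.TTheory GRing.Theory Num.Theory.
Local Open Scope ring_scope.

Definition wolstenholme_prime (p : nat) : Prop :=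
  prime p /\ 'C(2 * p - 1, p - 1) = 1 %[mod p ^ 4].

(* Since numq and denq are the components of the reduced fraction, this is
   congruence modulo p ^ e in the ring of rationals with denominator prime to p,
   for p prime.  The second conjunct is not redundant when e = 0. *)
Definition eqmodq (p e : nat) (a b : rat) : Prop :=
  ((p ^ e)%:Z %| numq (a - b))%Z /\ coprimez (denq (a - b)) p%:Z.

(* Main.v *)
Require Import Defs.
From mathcomp Require Import all_boot all_order all_algebra all_field.
From mathcomp Require Import ring zify.

Set Implicit Arguments.
Unset Strict Implicit.
Unset Printing Implicit Defensive.

Import Order.TTheory GRing.Theory Num.Theory.
Local Open Scope ring_scope.

(** Let g = (X + 1) ... (X + p - 1), with coefficients a_0 = (p-1)!, a_1, a_2, ...
    Up to the unit a_0 of the ring of p-integral rationals, the binomial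
    coefficient is g(p), the harmonic sum is a_1, and the sum of the inverse squares
    is a_1^2 - 2 a_0 a_2 (up to a_0^2).  Both conditions then become conditions
    on a_1, and they turn out to be the same one.

    Two facts about g suffice.  Modulo p it is X^(p-1) - 1, so p | a_i for
    0 < i < p - 1 ([dvdz_coef_rising_poly]).  And g(-p - x) = g(x)
    ([rising_poly_refl]), so that its derivatives of odd order are antisymmetric
    about -p/2; expanding them at -p yields p^2 | a_1, p^2 | a_5 and the finer
    a_3 = 2 p a_4 modulo p^4 ([rising_poly_coef_valuations]).

    For p > 7, expanding g(p) and g(-p) = a_0 modulo p^7 gives
    ([rising_poly_mod_p7]), with a_1 = p^2 b,
      g(p) - a_0 = 2 p^3 b modulo p^4, and
      a_0^2 (left member - right member) = 2 p^6 b^2 modulo p^7.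
    Hence being a Wolstenholme prime means p | b, and the congruence modulo p^7
    means p | b^2, which is the same.

    For p = 2, 3, 5, 7 both conditions are false, by computation. *)

(** * Congruence of fractions *)

Lemma numq_cross (x : rat) (n d : int) :
  d != 0 -> x = n%:~R / d%:~R -> n * denq x = numq x * d.
Proof.
move=> d0 ex; apply: (@intr_inj rat); rewrite !rmorphM /=.
rewrite numqE {2}ex mulrAC divfK ?intr_eq0 // mulrC.
Qed.

(** The congruence may be read off any fraction representing a - b whose
    denominator is prime to p: the reduced denominator divides that one, and
    Gauss's lemma moves the powers of p from one numerator to the other. *)
Lemma eqmodq_frac (p e : nat) (a b : rat) (n d : int) :
  coprimez d p -> d != 0 -> a - b = n%:~R / d%:~R ->
  eqmodq p e a b <-> ((p ^ e)%:Z %| n)%Z.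
Proof.
move=> cdp d0 /(numq_cross d0); rewrite /eqmodq.
set x := a - b => ex.
have ce y : coprimez y p -> coprimez (p ^ e)%:Z y.
  by rewrite !coprimezE /= => h; rewrite coprime_sym coprimeXr.
split=> [[dv cp]|dv].
  by rewrite -(@Gauss_dvdzl _ n (denq x)) ?ce // ex dvdz_mulr.
split; first by rewrite -(@Gauss_dvdzl _ _ d) ?ce // -ex dvdz_mulr.
have dd : (denq x %| d)%Z.
  rewrite -(@Gauss_dvdzr _ (numq x)) -?ex ?dvdz_mull //.
  by rewrite coprimezE coprime_sym coprime_num_den.
exact: coprimez_dvdl dd cdp.
Qed.

(** The simplest way to refute a congruence: the cofactor of p ^ e in the
    numerator is a unit, so p ^ e.+1 cannot divide.  The denominator need not be
    prime to p, which lets e be fixed in advance. *)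
Lemma not_eqmodq_of_cofactor (p e n d : nat) (a b : rat) :
  prime p -> (0 < d)%N -> ~~ (p %| n)%N ->
  a - b = p%:R ^+ e * n%:R / d%:R -> ~ eqmodq p e.+1 a b.
Proof.
move=> hp d0 pn eab [/dvdzP[m em] cp].
have d0' : d%:Z != 0 by rewrite -lt0n.
have p0 : p%:Z ^+ e != 0 by rewrite expf_neq0 // -lt0n prime_gt0.
have pe : (p ^ e.+1)%:Z = p%:Z * p%:Z ^+ e by rewrite -exprS -!natz natrX.
have /(numq_cross d0') : a - b = (p%:Z ^+ e * n%:Z)%:~R / d%:Z%:~R.
  by rewrite eab rmorphM rmorphXn.
move=> cross.
have /(mulfI p0) ed : p%:Z ^+ e * (n%:Z * denq (a - b))
    = p%:Z ^+ e * (p%:Z * (m * d%:Z)).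
  by rewrite mulrA cross em pe; ring.
case/negP: pn; rewrite -[(p %| n)%N]/(p%:Z %| n%:Z)%Z.
rewrite -(@Gauss_dvdzl _ _ (denq (a - b))) 1?coprimez_sym //.
by rewrite ed dvdz_mulr.
Qed.

(** * The polynomial whose coefficients are the symmetric functions of 1, ..., n-1 *)

(** The coefficient of degree i is (n-1)! times the i-th elementary symmetric
    function of 1, 1/2, ..., 1/(n-1); staying with these integers postpones all
    denominators to a single power of (n-1)!. *)
Definition rising_poly (n : nat) : {poly int} :=
  \prod_(1 <= k < n) ('X + (k%:R)%:P).

Lemma rising_polyS (n : nat) : (0 < n)%N ->
  rising_poly n.+1 = rising_poly n * ('X + (n%:R)%:P).
Proof. by move=> n0; rewrite /rising_poly big_nat_recr. Qed.

Lemma coef_rising_polyS (n i : nat) : (0 < n)%N ->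
  (rising_poly n.+1)`_i =
  (if i == 0%N then 0 else (rising_poly n)`_i.-1) + (rising_poly n)`_i * n%:R.
Proof. by move=> n0; rewrite rising_polyS // mulrDr coefD coefMX coefMC. Qed.

Lemma horner_rising_poly (n : nat) (x : int) :
  (rising_poly n).[x] = \prod_(1 <= k < n) (x + k%:R).
Proof.
rewrite /rising_poly horner_prod; apply: eq_bigr => k _.
by rewrite hornerD hornerX hornerC.
Qed.

Lemma rising_poly_at0 (n : nat) : (0 < n)%N ->
  (rising_poly n)`_0 = ((n.-1)`!)%:R.
Proof.
case: n => // n _; rewrite -horner_coef0 horner_rising_poly fact_prod natr_prod.
by apply: eq_bigr => k _; rewrite add0r.
Qed.

Lemma rising_poly_bin (n : nat) : (0 < n)%N ->
  (rising_poly n).[n%:R] = ((n.-1)`!)%:R * 'C(2 * n - 1, n - 1)%:R.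
Proof.
case: n => // n _; rewrite horner_rising_poly -natrM mulnC.
have -> : (2 * n.+1 - 1 = n + n.+1)%N by rewrite mul2n -addnn addSn subn1.
rewrite (subn1 n.+1) [n.+1.-1]/=.
rewrite bin_ffact ffact_prod natr_prod big_add1 /= big_mkord.
rewrite (reindex_inj rev_ord_inj) /=; apply: eq_bigr => i _.
rewrite -natrD; congr (_%:R).
by have := ltn_ord i; lia.
Qed.

(** Newton's identities in degrees one and two, divided by the appropriate power
    of the constant coefficient.  Both follow by induction from the recurrence
    a_i(n+1) = a_{i-1}(n) + n a_i(n). *)
Lemma power_sums_rising_poly (n : nat) (a := fun i => ((rising_poly n)`_i)%:~R : rat) :
  (0 < n)%N ->
  [/\ a 0%N != 0,
      \sum_(1 <= k < n) 1 / k%:R = a 1%N / a 0%N &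
      \sum_(1 <= k < n) 1 / k%:R ^+ 2 =
        (a 1%N ^+ 2 - 2 * a 0%N * a 2%N) / a 0%N ^+ 2].
Proof.
rewrite {}/a; elim: n => // -[_ _|n IHn _].
  rewrite !big_geq // /rising_poly big_geq // !coef1 /=.
  by split; rewrite // ?mul0r // expr0n mulr0 subr0 mul0r.
have [//|a0 s1 s2] := IHn.
have n0 : n.+1%:R != 0 :> rat by rewrite pnatr_eq0.
have c0 : (((rising_poly n.+2)`_0)%:~R : rat) =
    ((rising_poly n.+1)`_0)%:~R * n.+1%:R.
  by rewrite coef_rising_polyS // add0r intrM mulrz_nat.
have cS i : (((rising_poly n.+2)`_i.+1)%:~R : rat) =
    ((rising_poly n.+1)`_i)%:~R + ((rising_poly n.+1)`_i.+1)%:~R * n.+1%:R.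
  by rewrite coef_rising_polyS // intrD intrM mulrz_nat.
rewrite !(@big_nat_recr _ _ _ n.+1) // s1 s2 c0 !cS.
move: a0 n0; move: (n.+1%:R) => m; set u := _%:~R; set v := _%:~R; set w := _%:~R.
by move=> a0 n0; split=> /=; [rewrite mulf_neq0 | field; rewrite a0 n0..].
Qed.

Lemma prod_Fp (R : comNzRingType) (p : nat) (F : 'F_p -> R) : prime p ->
  \prod_(x : 'F_p) F x = \prod_(0 <= k < p) F k%:R.
Proof.
move=> hp; rewrite -[X in \prod_(0 <= k < X) _](Fp_cast hp).
by rewrite big_mkord; apply: eq_bigr => x _; rewrite natr_Zp.
Qed.

(** Modulo p, multiplying by X completes the product to one over all residues,
    which is X^p - X; only the two extreme coefficients survive. *)
Lemma dvdz_coef_rising_poly (p i : nat) : prime p -> (0 < i < p.-1)%N ->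
  (p %| (rising_poly p)`_i)%Z.
Proof.
move=> hp /andP[i0 ip].
have p0 := prime_gt0 hp.
have e : map_poly (intr : int -> 'F_p) (rising_poly p) * 'X = 'X^p - 'X.
  have := finField_genPoly 'F_p; rewrite card_Fp // => ->.
  rewrite (reindex_inj oppr_inj) /= prod_Fp // big_ltn // mulrC.
  rewrite oppr0 subr0 rmorph_prod; congr (_ * _); apply: eq_bigr => k _.
  by rewrite rmorphD /= map_polyX map_polyC /= mulrz_nat polyCN opprK.
have := congr1 (fun q : {poly 'F_p} => q`_i.+1) e.
rewrite coefMX /= coef_map coefB coefXn coefX /= eqSS (gtn_eqF i0) subr0.
rewrite ltn_eqF; last by rewrite -(prednK p0) ltnS.
by move/eqP; rewrite -(dvdz_pcharf (pchar_Fp hp)).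
Qed.

(** The substitution X -> -X - p sends the factor X + k to -(X + (p - k)), and
    there is an even number of factors.  This symmetry is the source of every
    congruence below. *)
Lemma rising_poly_refl (p : nat) : odd p ->
  rising_poly p \Po (- 'X - (p%:R)%:P) = rising_poly p.
Proof.
move=> op; rewrite /rising_poly rmorph_prod /=.
have sgn : \prod_(1 <= k < p) (-1) = 1 :> {poly int}.
  by rewrite prodr_const_nat; case: p op => // n; rewrite oddS subn1 -signr_odd /= => /negbTE ->.
rewrite big_nat_rev /= -[RHS]mul1r -[X in _ = X * _]sgn -big_split /=.
apply: eq_big_nat => k /andP[_ kp].
rewrite comp_polyD comp_polyX comp_polyC add1n subSS natrB 1?ltnW // polyCB.
by ring.
Qed.

(** * Consequences of the symmetry *)

Lemma horner_mod_pow (q : {poly int}) (x : int) (m : nat) :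
  exists r, q.[x] = \sum_(i < m) q`_i * x ^+ i + x ^+ m * r.
Proof.
exists (drop_poly m q).[x].
rewrite -{1}(poly_take_drop m q) hornerD hornerM hornerXn mulrC; congr (_ + _).
rewrite (horner_coef_wide _ (size_take_poly _ _)); apply: eq_bigr => i _.
by rewrite coef_take_poly ltn_ord.
Qed.

Lemma coprimez_pow_fact (p e n : nat) : prime p -> (n < p)%N ->
  coprimez (p ^ e)%:Z (n`!)%:Z.
Proof.
move=> hp np; rewrite coprimezE /= coprimeXl //.
elim: n np => [|n IHn] np; first by rewrite coprimen1.
by rewrite factS coprimeMr IHn ?(ltnW np) // andbT prime_coprime // gtnNdvd.
Qed.

(** Graph symmetry about the point -p/2, written without the fraction. *)
Definition odd_about (p : int) (h : {poly int}) : Prop :=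
  h \Po (- 'X - p%:P) = - h.

Lemma odd_about_deriv2 (p : int) (h : {poly int}) :
  odd_about p h -> odd_about p h^`()^`().
Proof.
move=> /(congr1 (fun q => q^`()^`())).
rewrite !(deriv_comp, derivM, derivB, derivN, derivX, derivC, derivE) => e.
by rewrite /odd_about -e; ring.
Qed.

Lemma odd_about_deriv (p : int) (g : {poly int}) :
  g \Po (- 'X - p%:P) = g -> odd_about p g^`().
Proof.
move=> /(congr1 deriv); rewrite deriv_comp derivB derivN derivX derivC => e.
by rewrite /odd_about -[in RHS]e; ring.
Qed.

(** Evaluating the antisymmetry at 0 compares h(0) with h(-p), and expanding
    h(-p) in powers of p expresses the constant coefficient by the later ones. *)
Lemma odd_about_coef0 (p : int) (h : {poly int}) : odd_about p h ->
  exists r, 2 * h`_0 = p * h`_1 - p ^+ 2 * h`_2 + p ^+ 3 * h`_3 + p ^+ 4 * r.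
Proof.
move=> /(congr1 (fun q => q.[0])).
rewrite horner_comp !hornerE -horner_coef0.
have [r ->] := horner_mod_pow h (- p) 4.
rewrite !big_ord_recl big_ord0 /= -horner_coef0 => e; exists (- r).
rewrite mulr2n mulrDl mul1r; apply/eqP; rewrite -subr_eq0; apply/eqP.
rewrite -{2}[h.[0]]opprK -e /bump /=; ring.
Qed.

(** In the expansion of twice h(0) the only term not visibly divisible by p ^ 2
    is p h_1.  Applied to derivatives of the rising polynomial, this is
    Wolstenholme's theorem for the odd symmetric functions. *)
Lemma odd_about_coef0_sqr (p : nat) (h : {poly int}) : prime p -> (2 < p)%N ->
  odd_about p h -> (p %| h`_1)%Z -> ((p ^ 2)%:Z %| h`_0)%Z.
Proof.
move=> hp p2 /odd_about_coef0[r e] /dvdzP[b h1].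
have c2 : coprimez (p ^ 2)%:Z 2 by exact: (@coprimez_pow_fact p 2 2).
rewrite -(Gauss_dvdzr _ c2) e h1; apply/dvdzP.
exists (b - h`_2 + p%:Z * h`_3 + p%:Z ^+ 2 * r).
by ring.
Qed.

(** The derivatives of odd order are antisymmetric, and their constant
    coefficients are a_1, 3! a_3 and 5! a_5.  Together with p | a_i this bounds the
    valuations; for a_3 the expansion is used to order p ^ 4, where the terms in
    a_5 and a_6 are already negligible.  The bound on p makes 6 < p - 1, so that
    p | a_6. *)
Lemma rising_poly_coef_valuations (p : nat) (a := fun i => (rising_poly p)`_i) :
  prime p -> (7 < p)%N ->
  exists b1 b4 b5 b6 c : int,
    [/\ a 1%N = p%:Z ^+ 2 * b1, a 4%N = p%:Z * b4, a 5%N = p%:Z ^+ 2 * b5,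
        a 6%N = p%:Z * b6 & a 3%N = 2 * p%:Z * a 4%N + p%:Z ^+ 4 * c].
Proof.
move=> hp p7.
have op : odd p by case: (even_prime hp) p7 => [->|].
have p2 : (2 < p)%N by lia.
have d i : (0 < i < 7)%N -> (p %| a i)%Z.
  by move=> ?; apply: dvdz_coef_rising_poly => //; lia.
have o1 : odd_about p (rising_poly p)^`().
  by rewrite -natz; apply/odd_about_deriv/rising_poly_refl.
have o3 := odd_about_deriv2 o1; have o5 := odd_about_deriv2 o3.
have cop e : coprimez (p ^ e)%:Z 120.
  by apply: (@coprimez_pow_fact p e 5) => //; lia.
have /dvdzP[b4 e4] := d 4 isT; have /dvdzP[b6 e6] := d 6 isT.
have /dvdzP[b1 e1] : ((p ^ 2)%:Z %| a 1%N)%Z.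
  have -> : a 1%N = (rising_poly p)^`()`_0 by rewrite coef_deriv.
  apply: odd_about_coef0_sqr => //.
  by rewrite coef_deriv -mulr_natr dvdz_mulr // d.
have /dvdzP[b5 e5] : ((p ^ 2)%:Z %| a 5%N)%Z.
  rewrite -(Gauss_dvdzr _ (cop 2)).
  have -> : 120 * a 5%N = (rising_poly p)^`()^`()^`()^`()^`()`_0.
    by rewrite !coef_deriv /a; ring.
  apply: odd_about_coef0_sqr => //.
  by rewrite !coef_deriv -/(a 6%N) e6; apply/dvdzP; exists (720 * b6); ring.
have /dvdzP[c ec] : ((p ^ 4)%:Z %| a 3%N - 2 * p%:Z * a 4%N)%Z.
  rewrite -(Gauss_dvdzr _ (cop 4)).
  have [r] := odd_about_coef0 o3.
  rewrite !coef_deriv -/(a 3%N) -/(a 4%N) -/(a 5%N) -/(a 6%N) e5 e6 => er.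
  (* The expansion concerns 12 a_3; the factor 10 brings it to 120 a_3, to use
     the same coprimality as for a_5. *)
  apply/dvdzP; exists (10 * (r + 120 * b6 - 60 * b5)).
  move: er; set L := LHS => er.
  have -> : 120 * (a 3%N - 2 * p%:Z * a 4%N) = 10 * L - 240 * p%:Z * a 4%N.
    by rewrite /L; ring.
  by rewrite er; ring.
exists b1, b4, b5, b6, c; rewrite e1 e4 e5 e6; split; try ring.
by move: ec; rewrite e4 => /eqP; rewrite subr_eq => /eqP ->; ring.
Qed.

(** * The binomial coefficient modulo p ^ 7 *)

(** Both sides of the theorem in terms of the single integer b = a_1 / p ^ 2.  With
    g(p) = (p-1)! 'C(2p-1, p-1) and g(-p) = g(0), the sum and the difference of the
    expansions of g(p) and g(-p) give g(p) - g(0) modulo p ^ 7 by the even or by the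
    odd coefficients alone.  Twice the even form minus the odd form is
    -2 p a_1 + 4 p^2 a_2 up to the term -2 p^3 (a_3 - 2 p a_4), which vanishes;
    what remains of the deviation from the harmonic sums is 2 p^2 a_1^2. *)
Lemma rising_poly_mod_p7 (p : nat) (a := fun i => (rising_poly p)`_i)
    (g := (rising_poly p).[p%:Z]) :
  prime p -> (7 < p)%N ->
  exists b u v : int,
    g - a 0%N = p%:Z ^+ 3 * (2 * b + p%:Z * u) /\
    a 0%N * g - a 0%N ^+ 2 + 2 * p%:Z * a 0%N * a 1%N
      + 2 * p%:Z ^+ 2 * (a 1%N ^+ 2 - 2 * a 0%N * a 2%N)
    = p%:Z ^+ 6 * (2 * b ^+ 2 + p%:Z * v).
Proof.
move=> hp p7.
have [b1 [b4 [b5 [b6 [c [e1 e4 e5 e6 e3]]]]]] := rising_poly_coef_valuations hp p7.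
rewrite -/(a 1%N) -/(a 3%N) -/(a 4%N) -/(a 5%N) -/(a 6%N) in e1 e4 e5 e6 e3.
have op : odd p by case: (even_prime hp) p7 => [->|].
have [r er] := horner_mod_pow (rising_poly p) p 7.
have [r' er'] := horner_mod_pow (rising_poly p) (- p%:Z) 7.
have refl0 : (rising_poly p).[- p%:Z] = a 0%N.
  have := congr1 (fun q => q.[0]) (rising_poly_refl op).
  by rewrite natz horner_comp !hornerE /a -(horner_coef0 (rising_poly p)).
move: er er'; rewrite refl0 -/g !big_ord_recl !big_ord0 /= /bump /= !add1n.
rewrite -![nth 0 _ _]/(a _) => er er'.
have even_part : g - a 0%N = 2 * (a 2%N * p%:Z ^+ 2 + a 4%N * p%:Z ^+ 4
     + a 6%N * p%:Z ^+ 6) + p%:Z ^+ 7 * (r - r').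
  transitivity (g + a 0%N - 2 * a 0%N); first by ring.
  by rewrite er {2}er'; ring.
have odd_part : g - a 0%N = 2 * (a 1%N * p%:Z + a 3%N * p%:Z ^+ 3
     + a 5%N * p%:Z ^+ 5) + p%:Z ^+ 7 * (r + r').
  by rewrite er {2}er'; ring.
(* The first congruence needs the odd form only, and the second combines both. *)
exists b1, (4 * p%:Z * b4 + p%:Z ^+ 3 * (2 * c + 2 * b5 + r + r')).
exists (a 0%N * (4 * b6 - 2 * c - 2 * b5 + r - 3 * r')); split.
  by rewrite odd_part e1 e3 e4 e5; ring.
set Z := LHS.
have -> : Z = a 0%N * (2 * (g - a 0%N) - (g - a 0%N) + 2 * p%:Z * a 1%N
    - 4 * p%:Z ^+ 2 * a 2%N) + 2 * p%:Z ^+ 2 * a 1%N ^+ 2.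
  by rewrite /Z; ring.
by rewrite {1}even_part odd_part e1 e3 e4 e5 e6; ring.
Qed.

Lemma prime_le7_or_gt7 (p : nat) : prime p -> (p \in [:: 2; 3; 5; 7]%N) || (7 < p)%N.
Proof. by case: ltnP; [rewrite orbT | do 8!case: p => // p]. Qed.

Theorem corollary4 (p : nat) (hp : prime p) :
  wolstenholme_prime p <->
  eqmodq p 7 ('C(2 * p - 1, p - 1)%:R)
    (1 - 2 * p%:R * (\sum_(1 <= k < p) 1 / k%:R)
       - 2 * p%:R ^+ 2 * (\sum_(1 <= k < p) 1 / k%:R ^+ 2)).
Proof.
have /orP[small | p7] := prime_le7_or_gt7 hp.
  (* For p <= 7 both sides fail: the difference of the two members is 14, 3^4/2,
     5^6/72, 7^6 29/1800, where the first two fractions are expanded to show p^6. *)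
  have not_wol : ~ wolstenholme_prime p.
    case=> _; move: small; rewrite !inE.
    by case/or4P => /eqP->; apply/eqP; vm_compute.
  split=> // cong; exfalso; move: cong.
  move: small hp => {not_wol}; rewrite !inE.
  have unroll (F : nat -> rat) n :
    \sum_(1 <= k < n) F k = \sum_(k <- iota 1 n.-1) F k.
    by rewrite /index_iota subn1.
  case/or4P => /eqP-> hp; rewrite !unroll.
  - have -> : 'C(2 * 2 - 1, 2 - 1) = 3%N by [].
    by rewrite !big_cons !big_nil; apply: (@not_eqmodq_of_cofactor _ _ 7 32); [| | |field].
  - have -> : 'C(2 * 3 - 1, 3 - 1) = 10%N by [].
    by rewrite !big_cons !big_nil; apply: (@not_eqmodq_of_cofactor _ _ 1 18); [| | |field].
  - have -> : 'C(2 * 5 - 1, 5 - 1) = 126%N by [].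
    by rewrite !big_cons !big_nil; apply: (@not_eqmodq_of_cofactor _ _ 1 72); [| | |field].
  - have -> : 'C(2 * 7 - 1, 7 - 1) = 1716%N by [].
    have -> : \sum_(k <- iota 1 6) 1 / k%:R = 49 / 20 :> rat.
      by rewrite !big_cons !big_nil; field.
    have -> : \sum_(k <- iota 1 6) 1 / k%:R ^+ 2 = 5369 / 3600 :> rat.
      by rewrite !big_cons !big_nil; field.
    by apply: (@not_eqmodq_of_cofactor _ _ 29 1800); [| | |field].
set C := 'C(_, _); have p0 := prime_gt0 hp.
have [b [u [v [eC eZ]]]] := rising_poly_mod_p7 hp p7.
have [] := power_sums_rising_poly p0.
have a0E := rising_poly_at0 p0; have := rising_poly_bin p0.
rewrite -a0E natz -/C => ga; rewrite {}ga in eC eZ; rewrite natz in a0E.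
set a := fun i => (rising_poly p)`_i.
rewrite -/(a 0%N) -/(a 1%N) -/(a 2%N) in a0E eC eZ *.
move=> a0 -> ->.
have cop e : coprimez (p ^ e)%:Z (a 0%N).
  by rewrite a0E; apply: coprimez_pow_fact; rewrite // prednK.
have powE e : (p ^ e)%:Z = p%:Z ^+ e by rewrite -!natz natrX.
have pow0 e : p%:Z ^+ e != 0 by rewrite expf_neq0 // -lt0n.
have c2 : coprimez p 2 by apply: (@coprimez_pow_fact p 1 2) => //; lia.
have half x y : (p %| 2 * x + p%:Z * y)%Z = (p %| x)%Z.
  by rewrite rpredDr; [exact: Gauss_dvdzr | exact: dvdz_mulr].
have wolE : wolstenholme_prime p <-> (p %| b)%Z.
  rewrite /wolstenholme_prime -/C.
  have -> : (C = 1 %[mod p ^ 4])%N <-> ((p ^ 4)%:Z %| C%:Z - 1)%Z.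
    by rewrite -eqz_mod_dvd !modz_nat; split=> [->|/eqP[]].
  rewrite -(Gauss_dvdzr _ (cop 4%N)) mulrBr mulr1 -natz eC powE (exprSr _ 3).
  rewrite dvdz_mul2l ?pow0 // half.
  by split=> [[]|].
have conE : (p%:Z ^+ 7 %| p%:Z ^+ 6 * (2 * b ^+ 2 + p%:Z * v))%Z = (p %| b)%Z.
  rewrite (exprSr _ 6) dvdz_mul2l ?pow0 // half.
  by rewrite !dvdzE /= abszX Euclid_dvdX // andbT.
rewrite wolE -conE -eZ -powE; symmetry.
(* Clearing a_0 ^ 2 turns the difference of the two members into the integer of
   [rising_poly_mod_p7]. *)
apply: (@eqmodq_frac _ _ _ _ _ (a 0%N ^+ 2)).
- by rewrite coprimez_sym coprimezXr // -[p]expn1.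
- by rewrite expf_neq0 // -(intr_eq0 rat).
by rewrite !rmorphD; field.
Qed.
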